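(* There is $n\in\mathbb{N}$ and there are $3$-tuples of commuting self-adjoint matrices $a=(a_1,a_2,a_3),\ b=(b_1,b_2,b_3)\in\mathcal{M}_n^3$ such that $$(\mathrm{id}_{\mathcal{M}_p}\otimes\mathrm{tr}_n)(f(a))\le(\mathrm{id}_{\mathcal{M}_p}\otimes\mathrm{tr}_n)(f(b))$$ for every $p\le\infty$ and every continuous convex nc function $f\in\mathcal{M}_p(\mathrm{C}(K))$, where $K$ is any closed nc $3$-ball containing $a$ and $b$, but there does not exist a trace-preserving unital completely positive map $\Phi:\mathcal{M}_n\to\mathcal{M}_n$ such that $\Phi(b_i)=a_i$ for all $1\le i\le 3$.
   Context: Conventions. Indices $m,n,p\le\infty$ range over $\{1,2,\dots\}\cup\{\infty\}$. For each $n\le\infty$ fix a complex Hilbert space $H_n$ of dimension $n$ ($H_\infty$ of countably infinite dimension). $\mathcal{M}_{m,n}$ is the space of bounded operators $H_n\to H_m$ with the weak* topology (the norm topology if $m,n<\infty$); $\mathcal{M}_n=\mathcal{M}_{n,n}$ with identity $1_n$; $\mathcal{M}=\sqcup_{n\le\infty}\mathcal{M}_n$. $\mathcal{M}_p(\mathcal{M}_n)$ is identified with the bounded operators on $H_p\otimes H_n$. $\alpha\ge\beta$ means $\alpha-\beta$ is positive. $\mathcal{M}_n^k$ has the product topology, and $\alpha x\beta=(\alpha x_1\beta,\dots,\alpha x_k\beta)$ for $x\in\mathcal{M}_n^k$. For $n<\infty$, $\mathrm{tr}_n$ is the trace on $\mathcal{M}_n$ normalized by $\mathrm{tr}_n(1_n)=1$.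 Closed nc $k$-ball. For $r>0$, the closed nc $k$-ball of radius $r$ is $K=\sqcup_{n\le\infty}K_n$ with $K_n=\{x\in\mathcal{M}_n^k:\sum_{i=1}^k x_ix_i^*\le r^2 1_n\}$. Nc functions. An nc function on $K$ is $f:K\to\mathcal{M}$ with: $f(K_n)\subseteq\mathcal{M}_n$ for all $n\le\infty$; $f(\sum_i\alpha_ix_i\alpha_i^* )=\sum_i\alpha_if(x_i)\alpha_i^*$ for every bounded sequence $x_i\in K_{n_i}$ and isometries $\alpha_i\in\mathcal{M}_{n,n_i}$ with $\sum_i\alpha_i\alpha_i^*=1_n$; and $f(\beta^*x\beta)=\beta^*f(x)\beta$ for $x\in K_n$ and unitary $\beta\in\mathcal{M}_n$. It is affine if moreover $f(\gamma^*x\gamma)=\gamma^*f(x)\gamma$ for all $x\in K_n$ and isometries $\gamma\in\mathcal{M}_{n,m}$. $\mathrm{B}(K)$ is the C*-algebra of bounded nc functions on $K$ with pointwise operations, adjoint $f^*(x)=f(x)^*$, and norm $\|f\|_\infty=\sup_{x\in K}\|f(x)\|$. $\mathrm{A}(K)\subseteq\mathrm{B}(K)$ is the space of affine nc functions whose restriction to each $K_n$, $n\le\infty$, is continuous into $\mathcal{M}_n$. $\mathrm{C}(K)\subseteq\mathrm{B}(K)$ is the C*-subalgebra generated by $\mathrm{A}(K)$; its elements are the continuous nc functions. $\mathcal{M}_p(\mathrm{B}(K))$ denotes the (bounded) $p\times p$ matrices over $\mathrm{B}(K)$, evaluated entrywise so that $f(x)\in\mathcal{M}_p(\mathcal{M}_n)$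 for $x\in K_n$, and $\mathcal{M}_p(\mathrm{C}(K))$ consists of those with entries in $\mathrm{C}(K)$. Convexity. A self-adjoint $f\in\mathcal{M}_p(\mathrm{B}(K))$ is convex if its epigraph $\{(x,\alpha):x\in K_n,\ \alpha\in\mathcal{M}_p(\mathcal{M}_n),\ \alpha\ge f(x),\ n\le\infty\}$ is an nc convex set, i.e. for every $n\le\infty$, bounded sequence $(x_i,T_i)$ in the epigraph at levels $n_i$, and $\alpha_i\in\mathcal{M}_{n_i,n}$ with $\sum_i\alpha_i^*\alpha_i=1_n$, the pair $(\sum_i\alpha_i^*x_i\alpha_i,\sum_i(1_p\otimes\alpha_i^* )T_i(1_p\otimes\alpha_i))$ is in the epigraph. Equivalently, $f(\alpha^*x\alpha)\le(1_p\otimes\alpha^* )f(x)(1_p\otimes\alpha)$ for all $m,n\le\infty$, $x\in K_n$ and isometries $\alpha\in\mathcal{M}_{n,m}$. *)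

(* Defs.v *)
From HB Require Import structures.
From mathcomp Require Import all_boot all_order all_algebra finmap.
From mathcomp Require Import complex ring lra.
From mathcomp Require Import all_classical all_reals all_analysis.
From mathcomp.analysis.showcase Require summability.
Set Implicit Arguments. Unset Strict Implicit. Unset Printing Implicit Defensive.
Import Order.TTheory GRing.Theory Num.Theory.
Import numFieldNormedType.Exports.
Import ComplexField.Normc.
Local Open Scope classical_set_scope.
Local Open Scope ring_scope.
Local Open Scope complex_scope.

Local Notation Re := complex.Re.
Local Notation Im := complex.Im.
Local Notation totally := summability.totally.
#[global] Existing Instance summability.totally_filter.

Section Usum.
Variables (R : realType) (I : choiceType).
Local Notation C := R[i].

Lemma normcC (z : C) : `|z| = (normc z)%:C. Proof. by []. Qed.
Lemma normc_ge0 (z : C) : 0 <= normc z.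
Proof. by case: z => a b /=; rewrite sqrtr_ge0. Qed.

Definition psum (V : nmodType) (f : I -> V) (A : {fset I}) : V := \sum_(i <- A) f i.

(* The sum of an unconditionally convergent family of complex numbers. *)
Definition usum (f : I -> C) : C := lim ((psum f A : C^o) @[A --> totally]).

Lemma psum_cvg_ge0 (f : I -> R) (M : R) : (forall i, 0 <= f i) ->
  (forall A, psum f A <= M) -> exists2 l, psum f @ totally --> l & forall A, psum f A <= l <= M.
Proof.
move=> f0 fM; pose S := range (psum f).
have S0 : S !=set0 by exists (psum f fset0); exists fset0.
have Sb : has_ubound S by exists M => _ [A _ <-].
have ubS A : psum f A <= sup S by apply: ub_le_sup => //; exists A.
exists (sup S); last first.
  by move=> A; rewrite ubS /=; apply: ge_sup => // _ [B _ <-].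
apply/cvgrPdist_le => /= e e0.
have [_ [A _ <-] hA] := sup_adherent e0 (conj S0 Sb).
exists A => //= B AB; rewrite ger0_norm ?subr_ge0//.
have : psum f A <= psum f B.
  rewrite /psum (big_fsetID _ (mem A) B)/=.
  have -> : [fset x in B | x \in A]%fset = A.
    apply/fsetP => x; rewrite !inE /=; case xA: (x \in A); rewrite ?andbF// (fsubsetP AB)//.
  by rewrite lerDl sumr_ge0.
move: hA; lra.
Qed.


Lemma ler_psum (f g : I -> R) A : (forall i, f i <= g i) -> psum f A <= psum g A.
Proof. by move=> fg; apply: ler_sum => i _. Qed.

Lemma psum_cvg (f : I -> R) (M : R) : (forall A, psum (fun i => `|f i|) A <= M) ->
  exists l : R, psum f @ totally --> l.
Proof.
move=> fM; pose g i := `|f i| + f i.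
have [|A|l lg _] := @psum_cvg_ge0 g (M + M).
- by move=> i; rewrite /g -lerBlDr sub0r ler_normr lexx orbT.
- apply: (@le_trans _ _ (psum (fun i => `|f i|) A + psum (fun i => `|f i|) A)).
    by rewrite /psum -big_split ler_sum//= => i _; rewrite lerD2l ler_norm.
  by rewrite lerD.
have [l' lf _] := psum_cvg_ge0 (fun i => normr_ge0 (f i)) fM.
exists (l - l').
have -> : psum f = psum g \- psum (fun i => `|f i|).
  apply/funext => A; rewrite /psum /= -sumrB; apply: eq_bigr => i _.
  by rewrite /g addrAC subrr add0r.
exact: cvgB.
Qed.

Lemma cvg_complex (T : Type) (F : set_system T) (FF : Filter F) (f g : T -> R) (a b : R) :
  f @ F --> a -> g @ F --> b ->
  (f x +i* g x : C^o) @[x --> F] --> (a +i* b : C^o).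
Proof.
move=> /cvgrPdist_lt fa /cvgrPdist_lt gb.
apply/cvgrPdist_lt => /= e e0.
have [r r0 re] : exists2 r : R, 0 < r & e = r%:C.
  by move: e0; rewrite ltcE /= => /andP[/eqP e1 e2]; exists (Re e) => //; case: e e1 e2 => ? ? /= -> _.
have r2 : 0 < r / 2 by rewrite divr_gt0.
near=> x.
have h1 : `|a - f x| < r / 2 by near: x; exact: fa.
have h2 : `|b - g x| < r / 2 by near: x; exact: gb.
have -> : (a +i* b : C^o) - (f x +i* g x) = (a - f x)%:C + 'i * (b - g x)%:C.
  by rewrite -[in RHS]/(_ +i* _); simpc.
rewrite re; apply: (le_lt_trans (ler_normD _ _)).
rewrite normrM (_ : `|'i%C : C| = 1) ?mul1r; last by rewrite normcC /= expr0n expr1n add0r sqrtr1.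
rewrite !normc_def /= !expr0n /= !addr0 !sqrtr_sqr -rmorphD ltcR.
by move: h1 h2; lra.
Unshelve. all: by end_near. Qed.

Definition bndsum (f : I -> C) M := forall A, psum (fun i => normc (f i)) A <= M.

Lemma normc_Re (z : C) : `|Re z| <= normc z.
Proof. by rewrite -lecR -normcC normc_ge_Re. Qed.
Lemma normc_Im (z : C) : `|Im z| <= normc z.
Proof. by case: z => a b /=; rewrite -sqrtr_sqr ler_wsqrtr // lerDr sqr_ge0. Qed.

Lemma psumRI (f : I -> C) A :
  psum f A = psum (fun i => Re (f i)) A +i* psum (fun i => Im (f i)) A.
Proof.
rewrite /psum; elim: (enum_fset A) => [|a s IH]; first by rewrite !big_nil.
by rewrite !big_cons IH; case: (f a).
Qed.

Lemma usum_is_cvg (f : I -> C) M : bndsum f M ->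
  (psum f A : C^o) @[A --> totally] --> (usum f : C^o).
Proof.
move=> fM.
have [a ha] : exists l : R, psum (fun i => Re (f i)) @ totally --> l.
  apply: (@psum_cvg _ M) => A; apply: le_trans (fM A); apply: ler_psum => i; exact: normc_Re.
have [b hb] : exists l : R, psum (fun i => Im (f i)) @ totally --> l.
  apply: (@psum_cvg _ M) => A; apply: le_trans (fM A); apply: ler_psum => i; exact: normc_Im.
have := cvg_complex _ ha hb; rewrite -(_ : psum f = fun x => _); last first.
  by apply/funext => A; rewrite psumRI.
move=> h; rewrite /usum; apply: cvgP (h _); exact: filter_filter'.
Qed.

Lemma usum_eq (f : I -> C) l : (psum f A : C^o) @[A --> totally] --> (l : C^o) -> usum f = l.
Proof. by move=> h; exact: (cvg_lim (@norm_hausdorff _ C^o) h). Qed.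

End Usum.

Section L2.
Variables (R : realType) (I : choiceType).
Local Notation C := R[i].

Definition sqsummable (v : I -> C) : Prop :=
  (\esum_(i in [set: I]) ((normc (v i)) ^+ 2)%:E < +oo)%E.

Lemma sqsummableP (v : I -> C) :
  sqsummable v <-> exists M, forall A, psum (fun i => normc (v i) ^+ 2) A <= M.
Proof.
split=> [vfin|[M vM]].
  exists (fine (\esum_(i in [set: I]) ((normc (v i)) ^+ 2)%:E)) => A.
  rewrite -lee_fin fineK; last first.
    by rewrite ge0_fin_numE// esum_ge0// => i _; rewrite lee_fin sqr_ge0.
  apply: esum_ge; exists [set` A]; first by split.
  by rewrite fsbig_finite//= set_fsetK sumEFin.
apply: (@le_lt_trans _ _ M%:E); last by rewrite ltry.
apply: ge_ereal_sup => _ [X [finX _] <-].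
by rewrite fsbig_finite//= sumEFin lee_fin vM.
Qed.

Definition l2_pred : {pred I -> C} := fun v => `[< sqsummable v >].

Lemma normcD2 (x y : C) : normc (x + y) ^+ 2 <= 2 * normc x ^+ 2 + 2 * normc y ^+ 2.
Proof.
have h : normc (x + y) <= normc x + normc y := le_normcD x y.
apply: (@le_trans _ _ ((normc x + normc y) ^+ 2)).
  by rewrite ler_sqr// nnegrE ?addr_ge0// normc_ge0.
have := sqr_ge0 (normc x - normc y); nra.
Qed.

Lemma l2_submod_closed : submod_closed l2_pred.
Proof.
split=> [|a u v /asboolP/sqsummableP [M uM] /asboolP/sqsummableP [N vN]].
  by apply/asboolP/sqsummableP; exists 0 => A; rewrite /psum big1// => i _; rewrite normc0 expr0n.
apply/asboolP/sqsummableP; exists (2 * normc a ^+ 2 * M + 2 * N) => A.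
apply: (@le_trans _ _ (2 * normc a ^+ 2 * psum (fun i => normc (u i) ^+ 2) A
   + 2 * psum (fun i => normc (v i) ^+ 2) A)).
  rewrite /psum !mulr_sumr -big_split; apply: ler_sum => i _ /=.
  by rewrite -mulrA -exprMn -normcM; exact: normcD2.
by rewrite lerD// ler_wpM2l// mulr_ge0// sqr_ge0.
Qed.

HB.instance Definition _ := GRing.isSubmodClosed.Build C (I -> C) l2_pred l2_submod_closed.

(* The Hilbert space l2(I) of square-summable families; its inner product dot is
   linear in the first argument. *)
Record l2 := L2 { l2val :> I -> C ; l2valP : l2val \in l2_pred }.
HB.instance Definition _ := [isSub for l2val].
HB.instance Definition _ := [Choice of l2 by <:].
HB.instance Definition _ := [SubChoice_isSubLmodule of l2 by <:].

Lemma l2E (u : l2) : {M | forall A, psum (fun i => normc (u i) ^+ 2) A <= M}.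
Proof. by apply: cid; apply/sqsummableP/asboolP; exact: l2valP. Qed.

Definition dot (u v : l2) : C := usum (fun i => u i * (v i)^*%C).
Definition hnorm (u : l2) : R := Num.sqrt (Re (dot u u)).

Lemma normc_conj (z : C) : normc (z^*%C) = normc z.
Proof. by case: z => a b /=; rewrite sqrrN. Qed.

Lemma cvg_conj (T : Type) (F : set_system T) (FF : Filter F) (f : T -> C) (l : C) :
  (f x : C^o) @[x --> F] --> (l : C^o) -> ((f x)^*%C : C^o) @[x --> F] --> (l^*%C : C^o).
Proof.
move=> /cvgrPdist_lt fl; apply/cvgrPdist_lt => e /fl; apply: filterS => x.
by rewrite -[X in _ -> `|X| < _]rmorphB normcJ.
Qed.

Lemma dotP (u v : l2) :
  (psum (fun i => u i * (v i)^*%C) A : C^o) @[A --> totally] --> (dot u v : C^o).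
Proof.
have [M uM] := l2E u; have [N vN] := l2E v.
apply: (@usum_is_cvg _ _ _ (M + N)) => A; apply: le_trans (lerD (uM A) (vN A)).
rewrite /psum -big_split; apply: ler_sum => i _ /=; rewrite normcM normc_conj.
have := sqr_ge0 (normc (u i) - normc (v i)).
have := mulr_ge0 (normc_ge0 (u i)) (normc_ge0 (v i)); nra.
Qed.

Lemma dot_eq (u v : l2) l :
  (psum (fun i => u i * (v i)^*%C) A : C^o) @[A --> totally] --> (l : C^o) -> dot u v = l.
Proof. exact: usum_eq. Qed.

Lemma dot_linear (w : l2) : scalar (dot^~ w).
Proof.
move=> a u v; apply: dot_eq.
have h := @cvgD _ C^o _ _ _ _ _ _ _ (@cvgZl_tmp _ C^o _ _ _ a _ _ (@dotP u w)) (@dotP v w).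
rewrite (_ : psum _ = (a \*: psum (fun i => u i * (w i)^*%C) : {fset I} -> C^o) \+
  (psum (fun i => v i * (w i)^*%C) : {fset I} -> C^o)) //; first exact: h.
apply/funext => A; rewrite /psum /= -[X in _ = X + _]/(a * _) mulr_sumr -big_split; apply: eq_bigr => i _ /=.
by rewrite mulrA -mulrDl.
Qed.

Lemma dot_conj (u v : l2) : (dot u v)^*%C = dot v u.
Proof.
apply/esym/dot_eq; have h := cvg_conj _ (@dotP u v).
rewrite (_ : psum _ = fun A => (psum (fun i => u i * (v i)^*%C) A)^*%C) //; first exact: h.
apply/funext => A; rewrite /psum rmorph_sum; apply: eq_bigr => i _ /=.
by rewrite rmorphM /= conjcK mulrC.
Qed.


Lemma dotDl (u v w : l2) : dot (u + v) w = dot u w + dot v w.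
Proof. by have := dot_linear w 1 u v; rewrite scale1r mul1r. Qed.
Lemma dot0l (w : l2) : dot 0 w = 0.
Proof. by apply: (addrI (dot 0 w)); rewrite -dotDl !addr0. Qed.
Lemma dotZl a (u w : l2) : dot (a *: u) w = a * dot u w.
Proof. by have := dot_linear w a u 0; rewrite !addr0 dot0l addr0. Qed.
Lemma dotDr (u v w : l2) : dot w (u + v) = dot w u + dot w v.
Proof. by rewrite -dot_conj dotDl rmorphD /= !dot_conj. Qed.
Lemma dotZr a (u w : l2) : dot w (a *: u) = a^*%C * dot w u.
Proof. by rewrite -dot_conj dotZl rmorphM /= dot_conj. Qed.
Lemma dotNl (u w : l2) : dot (- u) w = - dot u w.
Proof. by rewrite -scaleN1r dotZl mulN1r. Qed.
Lemma dotNr (u w : l2) : dot w (- u) = - dot w u.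
Proof. by rewrite -dot_conj dotNl rmorphN /= dot_conj. Qed.
Lemma dot_suml (J : Type) (r : seq J) (F : J -> l2) w :
  dot (\sum_(j <- r) F j) w = \sum_(j <- r) dot (F j) w.
Proof.
elim: r => [|j r IH]; first by rewrite !big_nil dot0l.
by rewrite !big_cons dotDl IH.
Qed.
Lemma dot_sumr (J : Type) (r : seq J) (F : J -> l2) w :
  dot w (\sum_(j <- r) F j) = \sum_(j <- r) dot w (F j).
Proof. by rewrite -dot_conj dot_suml rmorph_sum; apply: eq_bigr => j _ /=; rewrite dot_conj. Qed.

Definition nrm2 (u : l2) : R := Re (dot u u).

Lemma nrm2P (u : l2) : [/\ dot u u = (nrm2 u)%:C,
  forall A, psum (fun i => normc (u i) ^+ 2) A <= nrm2 u &
  forall M, (forall A, psum (fun i => normc (u i) ^+ 2) A <= M) -> nrm2 u <= M].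
Proof.
have [M uM] := l2E u.
have [||l lP lM] := @psum_cvg_ge0 _ _ (fun i => normc (u i) ^+ 2) M => //.
  by move=> i; exact: sqr_ge0.
have ul : dot u u = l%:C.
  apply: dot_eq.
  have h := cvg_complex _ lP (cvg_cst (0 : R)).
  rewrite (_ : psum _ = fun A => (psum (fun i => normc (u i) ^+ 2) A)%:C) //; first exact: h.
  apply/funext => A; rewrite /psum rmorph_sum; apply: eq_bigr => i _ /=.
  by rewrite -sqr_normc normcC rmorphXn.
rewrite /nrm2 ul; split => //= [A|N uN]; first by have /andP[] := lM A.
have [||l' lP' lM'] := @psum_cvg_ge0 _ _ (fun i => normc (u i) ^+ 2) N => //.
  by move=> i; exact: sqr_ge0.
have -> : l = l' by apply: (cvg_unique _ lP lP'); exact: norm_hausdorff.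
by have /andP[] := lM' fset0.
Qed.

Lemma dot_nrm2 u : dot u u = (nrm2 u)%:C. Proof. by have [] := nrm2P u. Qed.
Lemma psum_nrm2 (u : l2) A : psum (fun i => normc (u i) ^+ 2) A <= nrm2 u.
Proof. by have [] := nrm2P u. Qed.
Lemma nrm2_le (u : l2) M : (forall A, psum (fun i => normc (u i) ^+ 2) A <= M) -> nrm2 u <= M.
Proof. by have [_ _] := nrm2P u; apply. Qed.
Lemma nrm2_ge0 u : 0 <= nrm2 u.
Proof. by apply: le_trans (psum_nrm2 u fset0); rewrite /psum sumr_ge0// => i _; exact: sqr_ge0. Qed.
Lemma nrm2Z a u : nrm2 (a *: u) = normc a ^+ 2 * nrm2 u.
Proof.
apply: (@complexI R); rewrite -dot_nrm2 dotZl dotZr mulrA -sqr_normc dot_nrm2 rmorphM.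
by rewrite rmorphXn.
Qed.
Lemma nrm2D (u v : l2) : nrm2 (u + v) <= 2 * nrm2 u + 2 * nrm2 v.
Proof.
apply: nrm2_le => A.
apply: (@le_trans _ _ (2 * psum (fun i => normc (u i) ^+ 2) A + 2 * psum (fun i => normc (v i) ^+ 2) A)).
  by rewrite /psum !mulr_sumr -big_split; apply: ler_sum => i _ /=; exact: normcD2.
by rewrite lerD// ler_wpM2l// psum_nrm2.
Qed.
Lemma hnormE u : hnorm u = Num.sqrt (nrm2 u). Proof. by []. Qed.

Lemma nrm2_esum (u : l2) : (\esum_(i in [set: I]) ((normc (u i)) ^+ 2)%:E = (nrm2 u)%:E)%E.
Proof.
apply/eqP; rewrite eq_le; apply/andP; split.
  apply: ge_ereal_sup => _ [X [finX _] <-].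
  by rewrite fsbig_finite//= sumEFin lee_fin; exact: psum_nrm2.
have : sqsummable u by apply/asboolP; exact: l2valP.
rewrite /sqsummable => h.
rewrite -(@fineK _ (esum _ _)) ?ge0_fin_numE ?esum_ge0//; last by move=> i _; rewrite lee_fin sqr_ge0.
rewrite lee_fin; apply: nrm2_le => A; rewrite -lee_fin fineK; last first.
  by rewrite ge0_fin_numE// esum_ge0// => i _; rewrite lee_fin sqr_ge0.
by apply: esum_ge; exists [set` A] => //; rewrite fsbig_finite//= set_fsetK sumEFin.
Qed.

Lemma l2_ext (u v : l2) : (forall i, u i = v i) -> u = v.
Proof. by move=> uv; apply: val_inj; apply/funext. Qed.

Lemma mem_l2 (v : I -> C) M : (forall A, psum (fun i => normc (v i) ^+ 2) A <= M) -> v \in l2_pred.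
Proof. by move=> h; apply/asboolP/sqsummableP; exists M. Qed.

Lemma ket_subproof (i : I) : (fun j => (j == i)%:R) \in l2_pred.
Proof.
apply: (@mem_l2 _ 1) => A; rewrite /psum.
rewrite (eq_bigr (fun j => if j == i then 1 else 0)); last first.
  by move=> j _; case: eqP => _; rewrite ?normc1 ?normc0 ?expr1n ?expr0n.
rewrite -big_mkcond /= -big_filter.
have : (size [seq j <- A | j == i] <= 1)%N.
  by rewrite size_filter count_uniq_mem ?fset_uniq// leq_b1.
by case: [seq _ <- _ | _] => [|j [|]]//; rewrite ?big_nil ?big_seq1.
Qed.
Definition ket (i : I) : l2 := L2 (ket_subproof i).

Lemma dot_ket (u : l2) i : dot u (ket i) = u i.
Proof.
apply: dot_eq; apply: cvg_near_cst; exists [fset i]%fset => // A /= iA.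
have {}iA : i \in enum_fset A by apply: (fsubsetP iA); rewrite inE.
rewrite /psum (bigD1_seq i) ?fset_uniq//= eqxx conjc1 mulr1 big1 ?addr0// => j /negPf ->.
by rewrite conjc0 mulr0.
Qed.

End L2.

Section Bop.
Variables (R : realType).
Local Notation C := R[i].
Implicit Types I J K : choiceType.

Definition bop_pred I J : {pred l2 R J -> l2 R I} := fun T =>
  `[< linear T /\ exists c : R, forall v, hnorm (T v) <= c * hnorm v >].

Lemma hnorm_leP I J (T : l2 R J -> l2 R I) :
  (exists c : R, forall v, hnorm (T v) <= c * hnorm v) <->
  exists2 c : R, 0 <= c & forall v, nrm2 (T v) <= c * nrm2 v.
Proof.
split=> [[c Tc]|[c c0 Tc]].
  exists (c ^+ 2) => [|v]; first exact: sqr_ge0.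
  have h : hnorm (T v) <= `|c| * hnorm v.
    by apply: (le_trans (Tc v)); rewrite ler_wpM2r ?sqrtr_ge0 ?ler_norm.
  have : hnorm (T v) ^+ 2 <= (`|c| * hnorm v) ^+ 2.
    by rewrite ler_sqr// nnegrE ?mulr_ge0 ?sqrtr_ge0.
  by rewrite exprMn !sqr_sqrtr ?nrm2_ge0// real_normK ?num_real.
exists (Num.sqrt c) => v; rewrite -sqrtrM// ler_wsqrtr//.
exact: Tc.
Qed.

Lemma bop_submod_closed I J : submod_closed (@bop_pred I J).
Proof.
split=> [|a S T /asboolP[Sl /hnorm_leP[c c0 Sc]] /asboolP[Tl /hnorm_leP[d d0 Td]]].
  apply/asboolP; split=> [a u v|]; first by rewrite scaler0 addr0.
  by apply/hnorm_leP; exists 0 => // v; rewrite mul0r -(scale0r 0) nrm2Z normc0 expr0n mul0r.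
apply/asboolP; split=> [b u v|].
  rewrite -![(a *: S + T) _]/(a *: S _ + T _) Sl Tl !scalerDr !scalerA (mulrC a b).
  by rewrite -!addrA; congr (_ + _); rewrite addrCA.
apply/hnorm_leP; exists (2 * (normc a ^+ 2 * c) + 2 * d) => [|v].
  by rewrite addr_ge0// mulr_ge0// mulr_ge0// sqr_ge0.
apply: (le_trans (nrm2D _ _)); rewrite nrm2Z.
have h1 := ler_wpM2l (sqr_ge0 (normc a)) (Sc v); have h2 := Td v.
by move: h1 h2; rewrite mulrA; lra.
Qed.

HB.instance Definition _ I J := GRing.isSubmodClosed.Build C (l2 R J -> l2 R I)
  (@bop_pred I J) (@bop_submod_closed I J).

(* Bounded operators from l2 J to l2 I. *)
Record bop I J := Bop { bopval :> l2 R J -> l2 R I ; bopP : bopval \in @bop_pred I J }.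
HB.instance Definition _ I J := [isSub for @bopval I J].
HB.instance Definition _ I J := [Choice of bop I J by <:].
HB.instance Definition _ I J := [SubChoice_isSubLmodule of bop I J by <:].

Lemma bop_linear I J (T : bop I J) : linear T.
Proof. by have /asboolP[] := bopP T. Qed.
HB.instance Definition _ I J (T : bop I J) :=
  GRing.isLinear.Build C (l2 R J) (l2 R I) *:%R (bopval T) (@bop_linear I J T).

Lemma bop_bnd I J (T : bop I J) : exists2 c : R, 0 <= c & forall v, nrm2 (T v) <= c * nrm2 v.
Proof. by have /asboolP[_ /hnorm_leP] := bopP T. Qed.

Lemma mem_bop I J (T : l2 R J -> l2 R I) (c : R) : 0 <= c ->
  linear T -> (forall v, nrm2 (T v) <= c * nrm2 v) -> T \in @bop_pred I J.
Proof. by move=> c0 Tl Tc; apply/asboolP; split=> //; apply/hnorm_leP; exists c. Qed.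

Lemma bop1_subproof I : id \in @bop_pred I I.
Proof. by apply: (@mem_bop _ _ _ 1) => // v; rewrite mul1r. Qed.
Definition bop1 I : bop I I := Bop (bop1_subproof I).

Lemma bmul_subproof I J K (S : bop I J) (T : bop J K) : (S \o T) \in @bop_pred I K.
Proof.
have [c c0 Sc] := bop_bnd S; have [d d0 Td] := bop_bnd T.
apply: (@mem_bop _ _ _ (c * d)); rewrite ?mulr_ge0//.
  by move=> a u v; rewrite /= !linearP.
move=> v /=.
by apply: (le_trans (Sc _)); rewrite -mulrA ler_wpM2l.
Qed.
Definition bmul I J K (S : bop I J) (T : bop J K) : bop I K := Bop (bmul_subproof S T).

Lemma dot_bop_bnd I J (T : bop I J) (c : R) (v : l2 R I) (A : {fset J}) :
  0 < c -> (forall w, nrm2 (T w) <= c * nrm2 w) ->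
  psum (fun j => normc (dot v (T (ket R j))) ^+ 2) A <= c * nrm2 v.
Proof.
move=> c0 Tc; set a := fun j => dot v (T (ket R j)).
pose w := \sum_(j <- A) a j *: ket R j.
set S := psum _ A.
have aS : \sum_(j <- A) (a j)^*%C * a j = S%:C.
  rewrite /S /psum rmorph_sum; apply: eq_bigr => j _ /=.
  by rewrite mulrC -sqr_normc normcC rmorphXn.
have vTw : dot v (T w) = S%:C.
  rewrite /w linear_sum dot_sumr -aS; apply: eq_bigr => j _.
  by rewrite linearZ /= dotZr.
have nw : nrm2 w = S.
  apply: (@complexI R); rewrite -dot_nrm2 {2}/w dot_sumr -aS big_seq [RHS]big_seq.
  apply: eq_bigr => j jA; rewrite dotZr dot_ket; congr (_ * _).
  rewrite /w -[LHS]dot_ket dot_suml (bigD1_seq j) ?fset_uniq//=.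
  rewrite dotZl dot_ket /= eqxx mulr1 big1 ?addr0// => k kj.
  by rewrite dotZl dot_ket /= eq_sym (negPf kj) mulr0.
have E : nrm2 (c%:C *: v - T w) = c ^+ 2 * nrm2 v - (c * S + c * S) + nrm2 (T w).
  apply: (@complexI R); rewrite -dot_nrm2.
  rewrite !(dotDl, dotDr, dotNl, dotNr, dotZl, dotZr) -(dot_conj v (T w)) vTw !conjc_real !dot_nrm2.
  by rewrite !(rmorphD, rmorphN, rmorphM, rmorphXn) /=; ring.
have := nrm2_ge0 (c%:C *: v - T w); rewrite E.
have := Tc w; rewrite nw => h2 h1.
have {h1 h2} : 0 <= c * (c * nrm2 v - S) by move: h1 h2; nra.
by rewrite pmulr_rge0// subr_ge0.
Qed.

Lemma adj_l2_subproof I J (T : bop I J) (v : l2 R I) :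
  (fun j => dot v (T (ket R j))) \in @l2_pred R J.
Proof.
have [c c0 Tc] := bop_bnd T.
apply: (@mem_l2 _ _ _ ((c + 1) * nrm2 v)) => A; apply: dot_bop_bnd => [|w]; first lra.
by apply: (le_trans (Tc w)); rewrite ler_wpM2r ?nrm2_ge0//; lra.
Qed.
(* The coordinate j of T^* v is <T^* v, e_j> = <v, T e_j>; see adjP. *)
Definition adj_fun I J (T : bop I J) (v : l2 R I) : l2 R J := L2 (adj_l2_subproof T v).

Lemma adj_subproof I J (T : bop I J) : adj_fun T \in @bop_pred J I.
Proof.
have [c c0 Tc] := bop_bnd T.
apply: (@mem_bop _ _ _ (c + 1)); first lra.
  by move=> a u v; apply: l2_ext => j /=; rewrite dotDl dotZl.
move=> v; apply: nrm2_le => A /=; apply: dot_bop_bnd => [|w]; first lra.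
by apply: (le_trans (Tc w)); rewrite ler_wpM2r ?nrm2_ge0//; lra.
Qed.
Definition adj I J (T : bop I J) : bop J I := Bop (adj_subproof T).


Lemma dot_CS I (x y : l2 R I) : normc (dot x y) ^+ 2 <= nrm2 x * nrm2 y.
Proof.
have [y0|] := eqVneq (nrm2 y) 0.
  suff -> : y = 0 by rewrite -dot_conj dot0l conjc0 normc0 expr0n /= mulr_ge0// nrm2_ge0.
  apply: l2_ext => i; apply: eq0_normc; apply/eqP; rewrite -sqrf_eq0 eq_le sqr_ge0 andbT.
  by have := psum_nrm2 y [fset i]%fset; rewrite y0 /psum big_seq_fset1.
move=> y0; have {y0} y0 : 0 < nrm2 y by rewrite lt_def y0 nrm2_ge0.
set d := dot x y; pose t := (nrm2 y)^-1.
have dd : d * d^*%C = (normc d ^+ 2)%:C by rewrite -sqr_normc normcC rmorphXn.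
have E : nrm2 (x - (t%:C * d) *: y) = nrm2 x - (t * normc d ^+ 2 + t * normc d ^+ 2) + t ^+ 2 * normc d ^+ 2 * nrm2 y.
  apply: (@complexI R); rewrite -dot_nrm2.
  rewrite !(dotDl, dotDr, dotNl, dotNr, dotZl, dotZr) -(dot_conj x y) -/d !dot_nrm2.
  rewrite (_ : (t%:C * d)^*%C = t%:C * d^*%C); last by rewrite rmorphM /= oppr0.
  move: dd; move: (normc d ^+ 2) => N dd.
  by rewrite !(rmorphD, rmorphN, rmorphM, rmorphXn) /= -dd; ring.
have := nrm2_ge0 (x - (t%:C * d) *: y); rewrite E.
have tY : t * nrm2 y = 1 by rewrite mulVf ?gt_eqF.
have -> : t ^+ 2 * normc d ^+ 2 * nrm2 y = t * normc d ^+ 2 * (t * nrm2 y) by ring.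
rewrite tY mulr1.
rewrite opprD !addrA addrNK subr_ge0 => h.
by rewrite -ler_pdivrMr// mulrC.
Qed.

Lemma adjP I J (T : bop I J) u v : dot (T u) v = dot u (adj T v).
Proof.
apply/esym/dot_eq; have [c c0 Tc] := bop_bnd T.
pose S := psum (fun j => normc (u j) ^+ 2).
have [||l Sl /(_ fset0)/andP[_ lu]] := @psum_cvg_ge0 _ _ (fun j => normc (u j) ^+ 2) (nrm2 u).
- by move=> i; exact: sqr_ge0.
- exact: psum_nrm2.
have El : l = nrm2 u.
  apply/eqP; rewrite eq_le lu /=; apply: nrm2_le => A.
  have [||l' Sl' /(_ A)/andP[h _]] := @psum_cvg_ge0 _ _ (fun j => normc (u j) ^+ 2) (nrm2 u).
  - by move=> i; exact: sqr_ge0.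
  - exact: psum_nrm2.
  by rewrite (_ : l = l')//; apply: (cvg_unique _ Sl Sl'); exact: norm_hausdorff.
pose uA (A : {fset J}) := \sum_(j <- A) u j *: ket R j.
have uuA (A : {fset J}) : nrm2 (u - uA A) = nrm2 u - S A.
  have uSA : dot u (uA A) = (S A)%:C.
    rewrite /uA dot_sumr /S /psum rmorph_sum; apply: eq_bigr => j _ /=.
    by rewrite dotZr dot_ket mulrC -sqr_normc normcC rmorphXn.
  have SAA : dot (uA A) (uA A) = (S A)%:C.
    rewrite {2}/uA dot_sumr /S /psum rmorph_sum big_seq [RHS]big_seq; apply: eq_bigr => j jA /=.
    rewrite dotZr dot_ket rmorphXn /= -normcC sqr_normc mulrC; congr (_ * _).
    rewrite /uA -[LHS]dot_ket dot_suml (bigD1_seq j) ?fset_uniq//=.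
    rewrite dotZl dot_ket /= eqxx mulr1 big1 ?addr0// => k kj.
    by rewrite dotZl dot_ket /= eq_sym (negPf kj) mulr0.
  apply: (@complexI R); rewrite -dot_nrm2 !(dotDl, dotDr, dotNl, dotNr) -(dot_conj u (uA A)).
  rewrite uSA SAA conjc_real dot_nrm2 rmorphB /=; ring.
apply/cvgrPdist_lt => e e0.
have [r r0 ->] : exists2 r : R, 0 < r & e = r%:C.
  by move: e0; rewrite ltcE /= => /andP[/eqP e1 e2]; exists (Re e) => //; case: e e1 e2 => ? ? /= -> _.
have K0 : 0 < c * nrm2 v + 1 by rewrite ltr_wpDl// mulr_ge0// nrm2_ge0.
have /cvgrPdist_lt/(_ (r ^+ 2 / (c * nrm2 v + 1))) := Sl.
rewrite divr_gt0 ?exprn_gt0// => /(_ isT); apply: filterS => A hA.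
have -> : psum (fun j => u j * (adj T v j)^*%C) A = dot (T (uA A)) v.
  rewrite /uA linear_sum dot_suml; apply: eq_bigr => j _ /=.
  by rewrite linearZ dotZl dot_conj.
rewrite -[dot (T u) v - _]/(dot (T u) v - dot (T (uA A)) v) -dotNl -dotDl -linearB.
rewrite normcC ltcR -ltr_sqr ?nnegrE ?normc_ge0 ?ltW//.
apply: (le_lt_trans (dot_CS _ _)).
apply: (@le_lt_trans _ _ (c * nrm2 v * (nrm2 u - S A))).
  rewrite mulrAC ler_wpM2r ?nrm2_ge0 -?uuA//; exact: Tc.
have hS : nrm2 u - S A < r ^+ 2 / (c * nrm2 v + 1).
  by apply: le_lt_trans hA; rewrite -/(S A) El ler_norm.
have hS0 : 0 <= nrm2 u - S A by rewrite subr_ge0; exact: psum_nrm2.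
move: hS; rewrite ltr_pdivlMr// => hS; apply: le_lt_trans hS.
by rewrite mulrC ler_wpM2l// lerDl.
Qed.

Section Tensor.
Variables P J : choiceType.

Lemma slice_bound (f : P * J -> C) (g : P -> l2 R J) M :
  (forall s j, g s j = f (s, j)) -> (forall B, psum (fun s => nrm2 (g s)) B <= M) ->
  forall A, psum (fun k => normc (f k) ^+ 2) A <= M.
Proof.
move=> gf gM A; rewrite -lee_fin.
have : (\esum_(k in [set: P * J]) (normc (f k) ^+ 2)%:E <= M%:E)%E.
  have -> : [set: P * J] = [set: P] `*`` (fun _ => [set: J]) by apply/seteqP; split.
  rewrite (eq_esum (b := fun k => (normc (f (k.1, k.2)) ^+ 2)%:E)); last by move=> [].
  rewrite -(@esum_esum R P J setT (fun=> setT) (fun s j => (normc (f (s, j)) ^+ 2)%:E)); last first.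
    by move=> s j _ _; rewrite lee_fin sqr_ge0.
  rewrite (eq_esum (b := fun s => (nrm2 (g s))%:E)); last first.
    by move=> s _; rewrite -nrm2_esum; apply: eq_esum => j _; rewrite gf.
  apply: ge_ereal_sup => _ [X [finX _] <-].
  by rewrite fsbig_finite//= sumEFin lee_fin; exact: gM.
apply: le_trans; apply: esum_ge; exists [set` A] => //.
by rewrite fsbig_finite//= set_fsetK sumEFin.
Qed.

Lemma slice_subproof (w : l2 R (P * J)%type) (s : P) : (fun j => w (s, j)) \in @l2_pred R J.
Proof.
apply: (@mem_l2 _ _ _ (nrm2 w)) => A.
have -> : psum (fun j => normc (w (s, j)) ^+ 2) A =
    psum (fun k => normc (w k) ^+ 2) [fset (s, j) | j in A]%fset.
  by rewrite /psum big_imfset//= => x y _ _ [].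
exact: psum_nrm2.
Qed.
Definition slice (w : l2 R (P * J)%type) (s : P) : l2 R J := L2 (slice_subproof w s).

Lemma nrm2_slice (w : l2 R (P * J)%type) B : psum (fun s => nrm2 (slice w s)) B <= nrm2 w.
Proof.
rewrite -lee_fin -nrm2_esum.
have -> : [set: P * J] = [set: P] `*`` (fun _ => [set: J]) by apply/seteqP; split.
rewrite (eq_esum (b := fun k => (normc (w (k.1, k.2)) ^+ 2)%:E)); last by move=> [].
rewrite -(@esum_esum R P J setT (fun=> setT) (fun s j => (normc (w (s, j)) ^+ 2)%:E)); last first.
  by move=> s j _ _; rewrite lee_fin sqr_ge0.
apply: esum_ge; exists [set` B] => //.
rewrite fsbig_finite//= set_fsetK /psum -sumEFin; apply: lee_sum => s _.
by rewrite -nrm2_esum.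
Qed.

Lemma tens_bound (u : l2 R P) (v : l2 R J) A :
  psum (fun k => normc (u k.1 * v k.2) ^+ 2) A <= nrm2 u * nrm2 v.
Proof.
apply: (@slice_bound (fun k => u k.1 * v k.2) (fun s => u s *: v)) => // B.
apply: (@le_trans _ _ (psum (fun s => normc (u s) ^+ 2) B * nrm2 v)).
  by rewrite /psum mulr_suml ler_sum// => s _; rewrite nrm2Z.
by rewrite ler_wpM2r ?nrm2_ge0// psum_nrm2.
Qed.
Definition tens (u : l2 R P) (v : l2 R J) : l2 R (P * J)%type := L2 (mem_l2 (tens_bound u v)).

Lemma tensl_subproof (u : l2 R P) : tens u \in @bop_pred (P * J)%type J.
Proof.
apply: (@mem_bop _ _ _ (nrm2 u)); first exact: nrm2_ge0.
  by move=> a v w; apply: l2_ext => -[s j] /=; rewrite -[LHS]/(u s * (a * v j + w j)) -[RHS]/(a * (u s * v j) + u s * w j); ring.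
by move=> v; apply: nrm2_le; exact: tens_bound.
Qed.
Definition tensl (u : l2 R P) : bop (P * J)%type J := Bop (tensl_subproof u).

Lemma tensr_subproof (v : l2 R J) : tens^~ v \in @bop_pred (P * J)%type P.
Proof.
apply: (@mem_bop _ _ _ (nrm2 v)); first exact: nrm2_ge0.
  by move=> a u w; apply: l2_ext => -[s j] /=; rewrite -[LHS]/((a * u s + w s) * v j) -[RHS]/(a * (u s * v j) + w s * v j); ring.
by move=> u; rewrite mulrC; apply: nrm2_le; exact: tens_bound.
Qed.
Definition tensr (v : l2 R J) : bop (P * J)%type P := Bop (tensr_subproof v).

End Tensor.

Section Amp.
Variables (P I J : choiceType) (T : bop I J).

Lemma amp_bound (w : l2 R (P * J)%type) (c : R) : 0 <= c ->
  (forall v, nrm2 (T v) <= c * nrm2 v) ->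
  forall A, psum (fun k => normc (T (slice w k.1) k.2) ^+ 2) A <= c * nrm2 w.
Proof.
move=> c0 Tc; apply: (@slice_bound _ _ _ (fun s => T (slice w s))) => // B.
apply: (@le_trans _ _ (c * psum (fun s => nrm2 (slice w s)) B)).
  by rewrite /psum mulr_sumr ler_sum.
by rewrite ler_wpM2l// nrm2_slice.
Qed.

Lemma amp_l2_subproof (w : l2 R (P * J)%type) :
  (fun k : P * I => T (slice w k.1) k.2) \in @l2_pred R (P * I)%type.
Proof. by have [c c0 Tc] := bop_bnd T; exact: mem_l2 (amp_bound w c0 Tc). Qed.
Definition amp_fun (w : l2 R (P * J)%type) : l2 R (P * I)%type := L2 (amp_l2_subproof w).

Lemma amp_subproof : amp_fun \in @bop_pred (P * I)%type (P * J)%type.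
Proof.
have [c c0 Tc] := bop_bnd T.
apply: (mem_bop c0) => [a u v|v]; last by apply: nrm2_le; exact: amp_bound.
apply: l2_ext => -[s i] /=; rewrite -[RHS]/((a *: T (slice u s) + T (slice v s)) i) -linearP.
by congr (T _ _); apply: l2_ext.
Qed.
(* The operator 1 (x) T from l2 P (x) l2 J to l2 P (x) l2 I. *)
Definition amp : bop (P * I)%type (P * J)%type := Bop amp_subproof.
End Amp.

End Bop.
Section Operators.
Variable R : realType.
Local Notation C := R[i].
Implicit Types I J : choiceType.

(* A positive operator on a complex Hilbert space: <T v, v> is real and
   nonnegative for every v (the order of R[i] forces the imaginary part to
   vanish), so T is in particular self-adjoint. *)
Definition opos I (T : bop R I I) : Prop := forall v, 0 <= dot (T v) v.
Definition ople I (S T : bop R I I) : Prop := opos (T - S).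

Definition isometric I J (T : bop R I J) : Prop := bmul (adj T) T = bop1 R J.
Definition unitary I (T : bop R I I) : Prop := isometric T /\ isometric (adj T).
Definition self_adjoint I (T : bop R I I) : Prop := adj T = T.

Definition opnorm I J (T : bop R I J) : R :=
  sup [set hnorm (T v) | v in [set v | hnorm v <= 1]].

(* The weak* topology of B(H, K) as the dual of the trace class operators.  The
   weak* continuous functionals are T |-> \sum_k <T x_k, y_k> with
   \sum_k ||x_k||^2 and \sum_k ||y_k||^2 finite, that is
   T |-> <(1 (x) T) x, y> for x, y in l2(nat) (x) H and l2(nat) (x) K.  When H
   and K are finite-dimensional, this is the norm topology. *)
Definition normal_functionals I J (T : bop R I J) :
    {ptws (l2 R (nat * J)%type * l2 R (nat * I)%type) -> C^o} :=
  fun xy => dot (amp nat T xy.1) xy.2.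
HB.instance Definition _ I J :=
  Topological.copy (bop R I J) (initial_topology (@normal_functionals I J)).

(* Sums of operators are unordered weak* convergent sums, the limit along the
   finite subsets of the index type. *)
Definition has_opsum (N : choiceType) I J (T : N -> bop R I J) (S : bop R I J) : Prop :=
  psum T A @[A --> totally] --> S.

End Operators.

(* H_n is l2 (idx n).  Dimensions start at 1: Fin k is the dimension k + 1, and
   Inf the countably infinite dimension.  H_p (x) H_n is l2 (idx p * idx n). *)
Inductive ncdim := Fin of nat | Inf.
Definition idx (n : ncdim) : choiceType :=
  match n with Fin k => 'I_k.+1 | Inf => nat end.

(* opM R m n is the space of bounded operators from H_n to H_m, and opMp R p n
   is M_p(M_n), seen as the bounded operators on H_p (x) H_n. *)
Notation opM R m n := (bop R (idx m) (idx n)).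
Notation opMp R p n := (bop R (idx p * idx n)%type (idx p * idx n)%type).

Section NC.
Variables (R : realType) (k : nat).
Local Notation C := R[i].
Local Notation M m n := (opM R m n).
Local Notation Mp p n := (opMp R p n).

Definition tup (n : ncdim) := {ptws 'I_k -> M n n}.

Definition tsandwich m n (a : M m n) (x : tup n) (b : M n m) : tup m :=
  fun i => bmul a (bmul (x i) b).

Definition ncball (r : R) (n : ncdim) : set (tup n) :=
  [set x | ople (\sum_(i < k) bmul (x i) (adj (x i))) ((r ^+ 2)%:C *: bop1 R (idx n))].

(* Graded functions are total; every condition below, including membership in
   the generated C*-algebra, only involves their values on the ball. *)
Definition gfun := forall n : ncdim, tup n -> M n n.

(* The points x j lie in the ball, so the sequence x is bounded. *)
Definition preserves_direct_sums (r : R) (f : gfun) : Prop :=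
  forall (n N : ncdim) (d : idx N -> ncdim) (x : forall j, tup (d j))
    (a : forall j, M n (d j)) (y : tup n),
    (forall j, ncball r (x j)) -> (forall j, isometric (a j)) ->
    has_opsum (fun j => bmul (a j) (adj (a j))) (bop1 R (idx n)) ->
    (forall i, has_opsum (fun j => tsandwich (a j) (x j) (adj (a j)) i) (y i)) ->
    has_opsum (fun j => bmul (a j) (bmul (f _ (x j)) (adj (a j)))) (f n y).

Definition unitarily_equivariant (r : R) (f : gfun) : Prop :=
  forall (n : ncdim) (x : tup n) (b : M n n), ncball r x -> unitary b ->
    f n (tsandwich (adj b) x b) = bmul (adj b) (bmul (f n x) b).

Definition is_nc (r : R) (f : gfun) : Prop :=
  preserves_direct_sums r f /\ unitarily_equivariant r f.

Definition is_affine (r : R) (f : gfun) : Prop :=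
  forall (m n : ncdim) (x : tup n) (c : M n m), ncball r x -> isometric c ->
    f m (tsandwich (adj c) x c) = bmul (adj c) (bmul (f n x) c).

(* The C*-algebra B(K) of bounded nc functions on the ball K of radius r. *)
Definition BK (r : R) : set gfun :=
  [set f | is_nc r f /\
    exists c : R, forall n (x : tup n), ncball r x -> opnorm (f n x) <= c].

(* The space A(K): the topologies are the product of weak* topologies on the
   tuples and the weak* topology on the operators. *)
Definition AK (r : R) : set gfun :=
  [set f | [/\ BK r f, is_affine r f &
    forall n, {within @ncball r n, continuous (f n : tup n -> M n n)}]].

(* The last condition is closedness in the supremum norm over the ball. *)
Definition cstar_subalgebra (r : R) (S : set gfun) : Prop :=
  [/\ S `<=` BK r,
    forall (c : C) f g, S f -> S g -> S (fun n x => c *: f n x + g n x),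
    forall f g, S f -> S g -> S (fun n x => bmul (f n x) (g n x)),
    forall f, S f -> S (fun n x => adj (f n x)) &
    forall f, BK r f ->
      (forall e : R, 0 < e -> exists2 g, S g &
         forall n (x : tup n), ncball r x -> opnorm (f n x - g n x) <= e) -> S f].

(* The C*-subalgebra C(K) of B(K) generated by A(K). *)
Definition CK (r : R) : set gfun :=
  [set f | BK r f /\ forall S, cstar_subalgebra r S -> AK r `<=` S -> S f].

(* The entry (s, t) of T in M_p(M_n): J_s^* T J_t, where J_t v = e_t (x) v. *)
Definition block (p n : ncdim) (s t : idx p) (T : Mp p n) : M n n :=
  bmul (adj (tensl (idx n) (ket R s))) (bmul T (tensl (idx n) (ket R t))).

Definition gmfun (p : ncdim) := forall n : ncdim, tup n -> Mp p n.

(* Bounded p x p matrices with entries in C(K). *)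
Definition MpCK (r : R) (p : ncdim) : set (gmfun p) :=
  [set f | (exists c : R, forall n (x : tup n), ncball r x -> opnorm (f n x) <= c) /\
    forall s t : idx p, CK r (fun n x => block s t (f n x))].

Definition epigraph (r : R) p (f : gmfun p) (n : ncdim) : set (tup n * Mp p n) :=
  [set z | ncball r z.1 /\ ople (f n z.1) z.2].

(* amp (idx p) a is 1_p (x) a. *)
Definition nc_convex p (E : forall n, set (tup n * Mp p n)) : Prop :=
  forall (n N : ncdim) (d : idx N -> ncdim) (z : forall j, tup (d j) * Mp p (d j))
    (a : forall j, M (d j) n) (y : tup n) (S : Mp p n),
    (forall j, E (d j) (z j)) ->
    (exists c : R, forall j,
       (forall i, opnorm ((z j).1 i) <= c) /\ opnorm (z j).2 <= c) ->
    has_opsum (fun j => bmul (adj (a j)) (a j)) (bop1 R (idx n)) ->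
    (forall i, has_opsum (fun j => tsandwich (adj (a j)) (z j).1 (a j) i) (y i)) ->
    has_opsum (fun j => bmul (amp (idx p) (adj (a j))) (bmul (z j).2 (amp (idx p) (a j)))) S ->
    E n (y, S).

Definition self_adjoint_fun (r : R) p (f : gmfun p) : Prop :=
  forall n (x : tup n), ncball r x -> self_adjoint (f n x).

Definition convex_fun (r : R) p (f : gmfun p) : Prop :=
  self_adjoint_fun r f /\ nc_convex (epigraph r f).

End NC.

Section Trace.
Variables (R : realType) (n : nat).
Local Notation C := R[i].
Local Notation M := (opM R (Fin n) (Fin n)).

(* The normalized trace on operators on H_(Fin n), of dimension n + 1; the
   coordinate i of T e_i is <T e_i, e_i>. *)
Definition ntr (T : M) : C :=
  n.+1%:R^-1 * \sum_(i < n.+1) T (ket R i) i.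

(* (id (x) ntr)(T) = (n + 1)^-1 \sum_i V_i^* T V_i, where V_i u = u (x) e_i. *)
Definition id_ntr p (T : opMp R p (Fin n)) : opM R p p :=
  (n.+1%:R^-1 : C) *:
    \sum_(i < n.+1) bmul (adj (tensr (idx p) (ket R i))) (bmul T (tensr (idx p) (ket R i))).

(* The blockwise hypothesis says that T' = (id_{M_q} (x) Phi)(T). *)
Definition completely_positive (Phi : M -> M) : Prop :=
  forall (q : nat) (T T' : opMp R (Fin q) (Fin n)),
    (forall s t, block s t T' = Phi (block s t T)) -> opos T -> opos T'.

Definition trace_preserving (Phi : M -> M) : Prop := forall T, ntr (Phi T) = ntr T.

Definition unital (Phi : M -> M) : Prop := Phi (bop1 R _) = bop1 R _.

Definition commuting_self_adjoint k (a : tup R k (Fin n)) : Prop :=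
  (forall i, self_adjoint (a i)) /\ (forall i j, bmul (a i) (a j) = bmul (a j) (a i)).

End Trace.

(* Main.v *)
Require Import Defs.
From HB Require Import structures.
From mathcomp Require Import all_boot all_order all_algebra finmap.
From mathcomp Require Import complex ring lra.
From mathcomp Require Import all_classical all_reals all_analysis.
Set Implicit Arguments.
Unset Strict Implicit.
Unset Printing Implicit Defensive.
Import Order.TTheory GRing.Theory Num.Theory.
Local Open Scope classical_set_scope.
Local Open Scope ring_scope.

(** A single variable suffices: take [a = (A, 0, 0)] and [b = (B, 0, 0)] with
    [A = diag(12, -6, -6)] and [B = diag(10, 10, -20)].

    No unital positive map [Phi] sends [B] to [A], since [10 - B] is positive
    and [10 - A] is not; in other words [A] is not majorized by [B].

    An nc convex function [f] satisfies more than ordinary convexity: it obeys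
    a Jensen inequality for operator coefficients.  There are real matrices
    [c_0, c_1, c_2] ([coef]) with [\sum_j c_j^* c_j = 1] and
    [A = c_0^* B c_0 + 15 c_1^* c_1 - 6 c_2^* c_2], and any ball that contains [b]
    has radius at least 20, hence contains the scalar points 15 and -6.  So
    [f(a)] is at most the corresponding combination of [f(b)], [f(15)] and
    [f(-6)] ([convex_fun_sum]).  Moreover the constant vector
    [1 = e_0 + e_1 + e_2] satisfies [c_0 1 = 1] and [c_1 1 = c_2 1 = 0]
    ([coef_const]), so that the two scalar points disappear when the inequality
    is tested on [u (x) 1]:
    [<f(a) (u (x) 1), u (x) 1> <= <f(b) (u (x) 1), u (x) 1>]
    ([convex_fun_dot]).

    It remains to see that, up to the factor 1/3, both sides are the values at
    [u] of [(id (x) tr)(f(a))] and [(id (x) tr)(f(b))].  This holds because [a]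
    and [b] are diagonal: they commute with the reflections in the coordinate
    hyperplanes, hence so do the entries of [f(a)] and [f(b)] by unitary
    equivariance, and these entries are therefore diagonal
    ([equivariant_diagonal], [dot_id_ntr_diagonal]). *)

(** * Operators given by their matrix entries *)

Section BoundedOperators.
Variable R : realType.
Local Notation C := R[i].
Implicit Types I J K P : choiceType.
Local Notation ket := (ket R).

Lemma bopD I J (S T : bop R I J) v : (S + T) v = S v + T v. Proof. by []. Qed.
Lemma bopN I J (T : bop R I J) v : (- T) v = - T v. Proof. by []. Qed.
Lemma bopZ I J c (T : bop R I J) v : (c *: T) v = c *: T v. Proof. by []. Qed.
Lemma bop0 I J v : (0 : bop R I J) v = 0. Proof. by []. Qed.
Lemma bmulE I J K (S : bop R I J) (T : bop R J K) v : bmul S T v = S (T v).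
Proof. by []. Qed.
Lemma bop1E I v : bop1 R I v = v. Proof. by []. Qed.
Lemma l2D I (u v : l2 R I) i : (u + v) i = u i + v i. Proof. by []. Qed.
Lemma l2N I (u : l2 R I) i : (- u) i = - u i. Proof. by []. Qed.
Lemma l2Z I c (u : l2 R I) i : (c *: u) i = c * u i. Proof. by []. Qed.
Lemma ketE I (i j : I) : ket i j = (j == i)%:R. Proof. by []. Qed.

Lemma bop_sum I J (X : Type) (s : seq X) (F : X -> bop R I J) v :
  (\sum_(x <- s) F x) v = \sum_(x <- s) F x v.
Proof. by elim: s => [|x s IH]; rewrite ?big_nil// !big_cons bopD IH. Qed.

Lemma l2_sum I (X : Type) (s : seq X) (F : X -> l2 R I) i :
  (\sum_(x <- s) F x) i = \sum_(x <- s) F x i.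
Proof. by elim: s => [|x s IH]; rewrite ?big_nil// !big_cons l2D IH. Qed.

Lemma dot_adjl I J (T : bop R I J) u v : dot (adj T u) v = dot u (T v).
Proof. by rewrite -dot_conj -adjP dot_conj. Qed.

Lemma bop_scale I J (T : bop R I J) c v : T (c *: v) = c *: T v.
Proof. exact: linearZ. Qed.

Lemma bop_sumr I J (X : Type) (s : seq X) (T : bop R I J) (F : X -> l2 R J) :
  T (\sum_(x <- s) F x) = \sum_(x <- s) T (F x).
Proof. exact: linear_sum. Qed.

(** An operator is determined by its matrix entries. *)
Lemma bop_ext I J (S T : bop R I J) :
  (forall i j, S (ket j) i = T (ket j) i) -> S = T.
Proof.
move=> ST; have adjST v : adj S v = adj T v.
  by apply: l2_ext => j /=; congr dot; exact: l2_ext.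
apply: val_inj; apply/funext => u; apply: l2_ext => i.
by rewrite -[LHS]dot_ket -[RHS]dot_ket /= !adjP adjST.
Qed.

Lemma adj_ketE I J (T : bop R I J) i j : adj T (ket i) j = (T (ket j) i)^*%C.
Proof. by rewrite -[LHS]dot_ket dot_adjl -dot_conj dot_ket. Qed.

Lemma oplexx I (T : bop R I I) : ople T T.
Proof. by move=> v; rewrite subrr bop0 dot0l. Qed.

Lemma tens_sumr P J (X : Type) (s : seq X) (u : l2 R P) (F : X -> l2 R J) :
  tens u (\sum_(x <- s) F x) = \sum_(x <- s) tens u (F x).
Proof. exact: (linear_sum (tensl J u) s xpredT F). Qed.

Lemma tensv0 P J (u : l2 R P) : tens u (0 : l2 R J) = 0.
Proof. by have := linear0 (tensl J u). Qed.

Lemma tens_ket P J (s : P) (j : J) : tens (ket s) (ket j) = ket (s, j).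
Proof. by apply: l2_ext => -[t i] /=; rewrite xpair_eqE -mulnb natrM. Qed.

Lemma amp_tens P I J (T : bop R I J) (u : l2 R P) v : amp P T (tens u v) = tens u (T v).
Proof.
apply: l2_ext => -[s i]; rewrite -[LHS]/(T (slice (tens u v) s) i).
have -> : slice (tens u v) s = u s *: v by exact: l2_ext.
by rewrite bop_scale.
Qed.

Lemma adj_amp P I J (T : bop R I J) : adj (amp P (adj T)) = amp P T.
Proof.
apply: bop_ext => -[s i] [t j]; rewrite adj_ketE -!tens_ket !amp_tens.
rewrite -[tens (ket s) _ _]/(ket s t * adj T (ket i) j).
rewrite -[tens (ket t) _ _]/(ket t s * T (ket j) i) adj_ketE rmorphM /= conjcK.
by congr (_ * _); rewrite eq_sym; case: (_ == _); rewrite ?conjc0 ?conjc1.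
Qed.

Lemma dot_amp_adj P I J (T : bop R I J) u v :
  dot (amp P (adj T) u) v = dot u (amp P T v).
Proof. by rewrite adjP adj_amp. Qed.

Lemma block_ketE (p n : ncdim) (s t : idx p) (T : opMp R p n) i j :
  block s t T (ket j) i = T (ket (t, j)) (s, i).
Proof.
rewrite -dot_ket /block !bmulE dot_adjl.
by rewrite -[tensl _ _ (ket i)]/(tens _ _) -[tensl _ _ (ket j)]/(tens _ _) !tens_ket dot_ket.
Qed.

Lemma tensl_isometric P J (s : P) : isometric (tensl J (ket s)).
Proof.
apply: bop_ext => i j; rewrite bmulE -dot_ket dot_adjl.
rewrite -[tensl _ _ (ket i)]/(tens _ _) -[tensl _ _ (ket j)]/(tens _ _) !tens_ket.
by rewrite dot_ket bop1E /= xpair_eqE eqxx.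
Qed.

Section RankOne.
Variables (I J : choiceType) (x : l2 R I) (y : l2 R J).
Lemma rank1_subproof : (fun v => dot v y *: x) \in @bop_pred R I J.
Proof.
apply: (@mem_bop _ _ _ _ (nrm2 y * nrm2 x)); first by rewrite mulr_ge0// nrm2_ge0.
  by move=> a u v; rewrite dotDl dotZl scalerDl scalerA.
move=> v; rewrite nrm2Z [leRHS]mulrAC ler_wpM2r ?nrm2_ge0// [leRHS]mulrC; exact: dot_CS.
Qed.
(** The rank one operator [v |-> <v, y> x]. *)
Definition rank1 : bop R I J := Bop rank1_subproof.
End RankOne.

Lemma rank1E I J (x : l2 R I) (y : l2 R J) v : rank1 x y v = dot v y *: x.
Proof. by []. Qed.

(** A real matrix, as an operator between finite-dimensional Hilbert spaces. *)
Definition mxop m n (A : 'M[R]_(m, n)) : bop R 'I_m 'I_n :=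
  \sum_(i < m) \sum_(j < n) ((A i j)%:C)%C *: rank1 (ket i) (ket j).

Lemma mxop_ketE m n (A : 'M[R]_(m, n)) i j : mxop A (ket j) i = ((A i j)%:C)%C.
Proof.
transitivity (\sum_(k < m) \sum_(l < n) ((A k l)%:C)%C * ((j == l)%:R * (i == k)%:R) : C).
  rewrite /mxop bop_sum l2_sum; apply: eq_bigr => k _.
  rewrite bop_sum l2_sum; apply: eq_bigr => l _.
  by rewrite bopZ rank1E !l2Z dot_ket !ketE eq_sym.
rewrite (bigD1 i)//= [X in _ + X]big1 => [|k /negPf ki].
  rewrite addr0 (bigD1 j)//= [X in _ + X]big1 => [|l /negPf lj].
    by rewrite !eqxx !mulr1 addr0.
  by rewrite eq_sym lj mul0r mulr0.
by rewrite big1// => l _; rewrite [i == _]eq_sym ki !mulr0.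
Qed.

Lemma mxopB m n (A B : 'M[R]_(m, n)) : mxop (A - B) = mxop A - mxop B.
Proof. by apply: bop_ext => i j; rewrite bopD bopN l2D l2N !mxop_ketE !mxE rmorphB. Qed.

Lemma mxop_scalar n (c : R) : mxop (c%:M : 'M[R]_n) = c%:C%C *: bop1 R 'I_n.
Proof.
apply: bop_ext => i j; rewrite bopZ l2Z !mxop_ketE mxE ketE.
by case: eqP => _; rewrite ?mulr1 ?mulr0.
Qed.

Lemma l2_ord n (v : l2 R 'I_n) : v = \sum_(i < n) v i *: ket i.
Proof.
apply: l2_ext => i; rewrite l2_sum.
transitivity (\sum_(k < n) v k * (i == k)%:R : C); last exact: eq_bigr.
rewrite (bigD1 i)//= eqxx mulr1 [X in _ + X]big1 ?addr0// => k /negPf ki.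
by rewrite eq_sym ki mulr0.
Qed.

Lemma mxop_vE m n (A : 'M[R]_(m, n)) v i : mxop A v i = \sum_(j < n) v j * ((A i j)%:C)%C.
Proof.
rewrite {1}(l2_ord v) bop_sumr l2_sum; apply: eq_bigr => j _.
by rewrite bop_scale l2Z mxop_ketE.
Qed.

Lemma mxopM m n p (A : 'M[R]_(m, n)) (B : 'M[R]_(n, p)) :
  mxop (A *m B) = bmul (mxop A) (mxop B).
Proof.
apply: bop_ext => i j; rewrite bmulE mxop_ketE mxop_vE mxE rmorph_sum; apply: eq_bigr => k _.
by rewrite mxop_ketE rmorphM mulrC.
Qed.

Lemma adj_mxop m n (A : 'M[R]_(m, n)) : adj (mxop A) = mxop A^T.
Proof. by apply: bop_ext => i j; rewrite adj_ketE !mxop_ketE mxE conjc_real. Qed.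

Lemma opos_scalar I (c : R) : 0 <= c -> opos (c%:C%C *: bop1 R I).
Proof. by move=> c0 v; rewrite bopZ dotZl dot_nrm2 mulr_ge0// lecR// nrm2_ge0. Qed.

Lemma has_opsum_fin n I J (T : 'I_n -> bop R I J) : has_opsum T (\sum_(j < n) T j).
Proof.
apply: cvg_near_cst; exists [fset j | j : 'I_n]%fset => // A /= iA.
rewrite /psum big_uniq ?fset_uniq//=; apply: eq_bigl => j.
by apply: (fsubsetP iA); rewrite in_imfset.
Qed.

End BoundedOperators.

(** * Values of equivariant functions at diagonal tuples *)

Section DiagonalTuples.
Variables (R : realType) (k : nat).
Local Notation C := R[i].
Local Notation ket := (ket R).

(** The entries of [b^* T b] when [b] is diagonal with entries [s]. *)
Lemma sandwich_diagE (n : ncdim) (s : idx n -> C) (b T : opM R n n) i j :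
    (forall l, b (ket l) = s l *: ket l) ->
  bmul (adj b) (bmul T b) (ket j) i = (s i)^*%C * s j * T (ket j) i.
Proof.
move=> bE; rewrite -[LHS]dot_ket bmulE dot_adjl !bmulE !bE bop_scale.
by rewrite dotZr dotZl dot_ket mulrA.
Qed.

(** The reflection in the hyperplane orthogonal to the basis vector [i]. *)
Definition reflection (I : choiceType) (i : I) : bop R I I :=
  bop1 R I - 2 *: rank1 (ket i) (ket i).

Lemma reflection_ket (I : choiceType) (i j : I) :
  reflection i (ket j) = (-1) ^+ (i == j) *: ket j.
Proof.
rewrite /reflection bopD bopN bopZ bop1E rank1E dot_ket ketE.
have [->|_] := eqVneq i j; last by rewrite scale0r scaler0 subr0 expr0 scale1r.
by rewrite scale1r expr1 scaleN1r scaler_nat mulr2n opprD addrA subrr sub0r.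
Qed.

Lemma conjc_mul (x y : C) : (x * y)^*%C = x^*%C * y^*%C.
Proof. exact: (rmorphM (@conjc R)). Qed.

Lemma conjc_sign (b : bool) : ((-1) ^+ b : C)^*%C = (-1) ^+ b.
Proof. exact: (rmorph_sign (@conjc R)). Qed.

Lemma reflection_unitary (n : ncdim) (i : idx n) : unitary (reflection i).
Proof.
have adjE : adj (reflection i) = reflection i.
  apply: bop_ext => l j; rewrite adj_ketE !reflection_ket !l2Z conjc_mul conjc_sign !ketE.
  rewrite [l == j]eq_sym; have [->|_] := eqVneq j l; first by rewrite conjc1.
  by rewrite conjc0 !mulr0.
have iso : isometric (reflection i).
  rewrite /isometric adjE; apply: bop_ext => l j.
  by rewrite bmulE reflection_ket bop_scale reflection_ket scalerA -expr2 sqrr_sign scale1r.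
by split; rewrite ?adjE.
Qed.

(** A unitarily equivariant function maps a diagonal tuple to a diagonal
    operator, because the image commutes with the reflections in the
    coordinate hyperplanes, as the tuple does. *)
Lemma equivariant_diagonal r (g : gfun R k) n (x : tup R k n) (i j : idx n) :
    unitarily_equivariant r g -> ncball r x ->
    (forall l (s t : idx n), s != t -> x l (ket t) s = 0) ->
  i != j -> g n x (ket j) i = 0.
Proof.
move=> gu xr xd ij.
have xE : tsandwich (adj (reflection i)) x (reflection i) = x.
  apply/funext => l; apply: bop_ext => s t.
  rewrite (sandwich_diagE _ _ _ (reflection_ket i)).
  have [->|st] := eqVneq s t; last by rewrite xd ?mulr0.
  by rewrite conjc_sign -expr2 sqrr_sign mul1r.
have := gu n x _ xr (reflection_unitary i); rewrite xE.
move=> /(congr1 (fun T : opM R n n => T (ket j) i)).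
rewrite (sandwich_diagE _ _ _ (reflection_ket i)) conjc_sign eqxx (negPf ij).
rewrite expr1 expr0 mulr1 mulN1r => /eqP.
by rewrite -addr_eq0 -mulr2n mulrn_eq0 => /eqP.
Qed.

(** When the blocks of [F] are diagonal, the partial trace can be computed with
    the constant vector, since the cross terms vanish. *)
Lemma id_ntr_diagonal n p (F : opMp R p (Fin n)) :
    (forall s t (i j : 'I_n.+1), i != j -> F (ket (t, j)) (s, i) = 0) ->
  id_ntr F = (n.+1%:R^-1 : C) *: bmul (adj (tensr (idx p) (\sum_(i < n.+1) ket i)))
    (bmul F (tensr (idx p) (\sum_(i < n.+1) ket i))).
Proof.
move=> Fd; rewrite /id_ntr; congr (_ *: _); apply: bop_ext => s t.
rewrite bop_sum l2_sum -[RHS]dot_ket bmulE dot_adjl !bmulE.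
rewrite -![tensr _ _ _]/(tens _ _) !tens_sumr bop_sumr dot_suml.
apply: eq_bigr => j _; rewrite dot_sumr (bigD1 j)//= [X in _ + X]big1 => [|i ij].
  by rewrite addr0.
by rewrite !tens_ket dot_ket Fd.
Qed.

Lemma dot_id_ntr_diagonal r p (f : gmfun R k p) n (x : tup R k (Fin n)) u :
    MpCK r f -> ncball r x -> (forall l (s t : 'I_n.+1), s != t -> x l (ket t) s = 0) ->
  let w := tens u (\sum_(i < n.+1) ket i) in
  dot (id_ntr (f (Fin n) x) u) u = n.+1%:R^-1 * dot (f (Fin n) x w) w.
Proof.
move=> [_ fC] xr xd w; rewrite id_ntr_diagonal => [|s t i j ij].
  by rewrite bopZ dotZl bmulE dot_adjl.
have [[[_ gu] _] _] := fC s t.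
by rewrite -block_ketE; exact: (equivariant_diagonal gu).
Qed.

End DiagonalTuples.

(** * The Jensen inequality for nc convex functions *)

Section Jensen.
Variables (R : realType) (k : nat) (r : R) (p : ncdim).

(** Convexity for finite nc convex combinations of points of the same level. *)
Lemma convex_fun_sum (f : gmfun R k p) N m n (z : 'I_N.+1 -> tup R k m) (c : 'I_N.+1 -> opM R m n)
    (x : tup R k n) :
    convex_fun r f -> (forall j, ncball r (z j)) ->
    \sum_j bmul (adj (c j)) (c j) = bop1 R (idx n) ->
    (forall i, x i = \sum_j tsandwich (adj (c j)) (z j) (c j) i) ->
  ople (f n x) (\sum_j bmul (amp (idx p) (adj (c j))) (bmul (f m (z j)) (amp (idx p) (c j)))).
Proof.
move=> [_ fconv] zr c1 xE.
apply: (proj2 (fconv n (Fin N) (fun=> m) (fun j => (z j, f m (z j))) c x _ _ _ _ _ _)) => /=.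
- by move=> j; split => //=; exact: oplexx.
(* The family is finite, so it is bounded by the sum of all the norms. *)
- pose B j := \sum_i `|opnorm (z j i)| + `|opnorm (f m (z j))|.
  have B0 j i : opnorm (z j i) <= \sum_i `|opnorm (z j i)|.
    by rewrite (bigD1 i)//= (le_trans (ler_norm _))// lerDl sumr_ge0.
  have Bj j : B j <= \sum_j B j.
    by rewrite [leRHS](bigD1 j)//= lerDl sumr_ge0// => i _; rewrite addr_ge0// sumr_ge0.
  exists (\sum_j B j) => j; split=> [i|]; apply: le_trans (Bj j).
    by rewrite (le_trans (B0 j i))// lerDl.
  by rewrite (le_trans (ler_norm _))// lerDr sumr_ge0.
- by rewrite -c1; exact: has_opsum_fin.
- by move=> i; rewrite xE; exact: has_opsum_fin.
- exact: has_opsum_fin.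
Qed.

(** The Jensen inequality tested on [u (x) v], when all but one of the
    coefficients annihilate [v]. *)
Lemma convex_fun_dot (f : gmfun R k p) N m n (z : 'I_N.+1 -> tup R k m) (c : 'I_N.+1 -> opM R m n)
    (x : tup R k n) (u : l2 R (idx p)) (v : l2 R (idx n)) (w : l2 R (idx m)) :
    convex_fun r f -> (forall j, ncball r (z j)) ->
    \sum_j bmul (adj (c j)) (c j) = bop1 R (idx n) ->
    (forall i, x i = \sum_j tsandwich (adj (c j)) (z j) (c j) i) ->
    c ord0 v = w -> (forall j, j != ord0 -> c j v = 0) ->
  dot (f n x (tens u v)) (tens u v) <= dot (f m (z ord0) (tens u w)) (tens u w).
Proof.
move=> fc zr c1 xE cw c0; have /(_ (tens u v)) := convex_fun_sum fc zr c1 xE.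
rewrite bopD bopN dotDl dotNl subr_ge0 => /le_trans; apply.
rewrite bop_sum dot_suml.
under eq_bigr => j _ do rewrite bmulE dot_amp_adj bmulE !amp_tens.
rewrite (bigD1 ord0)//= cw [X in _ + X]big1 ?addr0// => j j0.
by rewrite c0// tensv0 -dot_conj dot0l conjc0.
Qed.

End Jensen.

(** * Completely positive maps are positive *)

Section CompletelyPositive.
Variables (R : realType) (n : nat).
Local Notation M := (opM R (Fin n) (Fin n)).

Lemma completely_positive_opos (Phi : M -> M) (T : M) :
  completely_positive Phi -> opos T -> opos (Phi T).
Proof.
(* M_1(M_n) is identified with M_n by the unitary X v = e_0 (x) v. *)
move=> PhiP T0; pose X := tensl 'I_n.+1 (ket R (ord0 : 'I_1)).
have XX : bmul (adj X) X = bop1 R _ := tensl_isometric R _ (ord0 : 'I_1).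
have XXE v : adj X (X v) = v by rewrite -bmulE XX.
have bX (S : M) (s t : 'I_1) :
    @block R (Fin 0) (Fin n) s t (bmul X (bmul S (adj X))) = S.
  rewrite [s]ord1 [t]ord1; apply: val_inj; apply/funext => v.
  by rewrite -[LHS]/(adj X (X (S (adj X (X v))))) !XXE.
have P0 : opos (bmul X (bmul (Phi T) (adj X)) : opMp R (Fin 0) (Fin n)).
  apply: (PhiP 0%N (bmul X (bmul T (adj X)))) => [s t|v]; first by rewrite !bX.
  by rewrite bmulE adjP bmulE.
by move=> v; have := P0 (X v); rewrite bmulE adjP bmulE XXE.
Qed.

End CompletelyPositive.

(** * Tuples with one nonzero component *)

Section SingleVariable.
Variables (R : realType) (k : nat).
Local Notation C := R[i].

(** The tuple [(T, 0, ..., 0)]. *)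
Definition first_tup n (T : opM R n n) : tup R k.+1 n := fun i => if i == ord0 then T else 0.

Lemma bmul0l I J K (T : bop R J K) : bmul (0 : bop R I J) T = 0.
Proof. exact: val_inj. Qed.

Lemma bmul0r I J K (T : bop R I J) : bmul T (0 : bop R J K) = 0.
Proof. by apply: val_inj; apply/funext => v; exact: linear0. Qed.

Lemma adj0 I J : adj (0 : bop R I J) = 0.
Proof. by apply: bop_ext => i j; rewrite adj_ketE !bop0 [LHS]conjc0. Qed.

Lemma first_tup_commuting n (T : opM R (Fin n) (Fin n)) :
  self_adjoint T -> commuting_self_adjoint (first_tup T).
Proof.
move=> Ts; split=> [i|i j]; rewrite /first_tup.
  by case: ifP => _ //; exact: adj0.
by do 2 case: ifP => _ //; rewrite ?bmul0l ?bmul0r.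
Qed.

Lemma tsandwich_first_tup m n (a : opM R m n) (T : opM R n n) (b : opM R n m) i :
  tsandwich a (first_tup T) b i = first_tup (bmul a (bmul T b)) i.
Proof. by rewrite /tsandwich /first_tup; case: ifP => _ //; rewrite bmul0l bmul0r. Qed.

Lemma first_tup_sum n (J : Type) (s : seq J) (T : J -> opM R n n) i :
  first_tup (\sum_(j <- s) T j) i = \sum_(j <- s) first_tup (T j) i.
Proof. by rewrite /first_tup; case: ifP => _ //; rewrite big1. Qed.

Lemma ncball_first_tup r n (T : opM R n n) :
  ncball r (first_tup T) <-> ople (bmul T (adj T)) ((r ^+ 2)%:C%C *: bop1 R (idx n)).
Proof.
rewrite /ncball /= (bigD1 ord0)//= [X in _ + X]big1 ?addr0// => i /negPf i0.
by rewrite /first_tup i0 bmul0l.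
Qed.

End SingleVariable.

Arguments first_tup {R} k {n} T.

(** * Real diagonal and scalar matrices *)

Section RealMatrices.
Variable R : realType.

Lemma mxop_sum m n (J : Type) (s : seq J) (A : J -> 'M[R]_(m, n)) :
  mxop (\sum_(j <- s) A j) = \sum_(j <- s) mxop (A j).
Proof.
apply: bop_ext => i j; rewrite mxop_ketE bop_sum l2_sum summxE rmorph_sum.
by apply: eq_bigr => l _; rewrite mxop_ketE.
Qed.

Lemma mxop_ones m n (A : 'M[R]_(m, n)) i :
  mxop A (\sum_(j < n) ket R j) i = ((A *m const_mx 1 : 'cV_m) i ord0)%:C%C.
Proof.
rewrite bop_sumr l2_sum mxE rmorph_sum; apply: eq_bigr => j _.
by rewrite mxop_ketE mxE mulr1.
Qed.

Lemma l2_sum_ket n (i : 'I_n) : (\sum_(j < n) ket R j) i = 1.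
Proof.
transitivity (\sum_(j < n) (i == j)%:R : R[i]); first exact: l2_sum.
by rewrite (bigD1 i)//= eqxx big1 ?addr0// => j /negPf; rewrite eq_sym => ->.
Qed.

Lemma mxop_diag_ge0 n (d : 'rV[R]_n) : (forall i, 0 <= d ord0 i) -> opos (mxop (diag_mx d)).
Proof.
move=> d0 v.
have -> : mxop (diag_mx d) v = \sum_i ((d ord0 i)%:C%C * v i) *: ket R i.
  rewrite {1}(l2_ord v) bop_sumr; apply: eq_bigr => i _.
  rewrite bop_scale mulrC -scalerA; congr (_ *: _); apply: l2_ext => j.
  rewrite mxop_ketE l2Z mxE ketE; have [->|_] := eqVneq j i; first by rewrite mulr1.
  by rewrite mulr0.
rewrite dot_suml sumr_ge0// => i _; rewrite dotZl -mulrA mulr_ge0 ?lecR//.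
by rewrite -dot_conj dot_ket -sqr_normc exprn_ge0.
Qed.

Lemma first_tup_diagonal k n (d : 'rV[R]_n.+1) l (s t : 'I_n.+1) : s != t ->
  first_tup k (mxop (diag_mx d) : opM R (Fin n) (Fin n)) l (ket R t) s = 0.
Proof.
move=> /negPf st; rewrite /first_tup; case: ifP => _; last by rewrite bop0.
by rewrite mxop_ketE mxE st.
Qed.

Lemma ncball_scalar k n (r c : R) : c ^+ 2 <= r ^+ 2 ->
  ncball r (first_tup k (mxop c%:M : opM R (Fin n) (Fin n))).
Proof.
move=> cr; apply/ncball_first_tup.
rewrite adj_mxop tr_scalar_mx -mxopM -scalar_mxM -expr2 mxop_scalar /ople -scalerBl -rmorphB.
by apply: opos_scalar; rewrite subr_ge0.
Qed.

Lemma ncball_diag_le k n (r : R) (d : 'rV[R]_n.+1) i :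
  ncball r (first_tup k (mxop (diag_mx d) : opM R (Fin n) (Fin n))) -> d ord0 i ^+ 2 <= r ^+ 2.
Proof.
move=> /ncball_first_tup /(_ (ket R i)).
rewrite adj_mxop tr_diag_mx -mxopM mulmx_diag bopD bopN bopZ bop1E dot_ket l2D l2N l2Z.
by rewrite mxop_ketE ketE eqxx !mxE eqxx mulr1 subr_ge0 lecR -expr2.
Qed.

End RealMatrices.

(** * The example *)

Section Example.
Variable R : realType.

(** With [va], [vb] and [vc] below, the vectors [1, va, vc] form an orthogonal basis
    and so do [1, vb] and [(1, -1, 0)]; [A] and [B] are the diagonal matrices with
    entries [6 va] and [10 vb]. *)
Definition va : seq R := [:: 2; -1; -1].
Definition vb : seq R := [:: 1; 1; -2].
Definition vc : seq R := [:: 0; 1; -1].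

Definition mxA : 'M[R]_3 := diag_mx (\row_i [:: 12; -6; -6]`_i).
Definition mxB : 'M[R]_3 := diag_mx (\row_i [:: 10; 10; -20]`_i).

(** The coefficients of the nc convex combination: [coef 0] fixes [1], maps [va]
    to [3/5 vb] and kills [vc]; [coef 1] is [4/5] times the orthogonal projection
    onto the line of [va], and [coef 2] is the orthogonal projection onto the line
    of [vc]. *)
Definition coef (j : 'I_3) : 'M[R]_3 :=
  match nat_of_ord j with
  | 0 => \matrix_(s, t) (1 / 3 + vb`_s * va`_t / 10)
  | 1 => \matrix_(s, t) (2 / 15 * (va`_s * va`_t))
  | _ => \matrix_(s, t) (vc`_s * vc`_t / 2)
  end.

(** The points of the nc convex combination: [B] and the scalars 15 and -6. *)
Definition pts (j : 'I_3) : 'M[R]_3 :=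
  match nat_of_ord j with 0 => mxB | 1 => 15%:M | _ => (-6)%:M end.

Lemma ptsP j : pts j = mxB \/ exists2 s, pts j = s%:M & s ^+ 2 <= 400.
Proof.
rewrite /pts; case: (nat_of_ord j) => [|[|_]]; first by left.
  by right; exists 15 => //; lra.
by right; exists (-6) => //; lra.
Qed.

Lemma sum3 (F : 'I_3 -> R) : \sum_i F i = F (inord 0) + F (inord 1) + F (inord 2).
Proof.
rewrite !big_ord_recl big_ord0 addr0 addrA.
by congr (F _ + F _ + F _); apply: val_inj; rewrite /= inordK.
Qed.

Lemma coef_sum1 : \sum_j (coef j)^T *m coef j = 1%:M.
Proof.
apply/matrixP => s t; rewrite summxE sum3 /coef !inordK//.
rewrite !mxE !sum3 !mxE !inordK//.
case: s t => [[|[|[|//]]] ?] [[|[|[|//]]] ?]; rewrite /=; lra.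
Qed.

Lemma coef_sumA : \sum_j (coef j)^T *m (pts j *m coef j) = mxA.
Proof.
apply/matrixP => s t; rewrite summxE sum3 /coef /pts !inordK//.
rewrite !mul_scalar_mx /mxB mul_diag_mx.
rewrite !mxE !sum3 !mxE !inordK//.
case: s t => [[|[|[|//]]] ?] [[|[|[|//]]] ?]; rewrite /=; lra.
Qed.

Lemma coef_const j : coef j *m const_mx 1 = (if j == ord0 then const_mx 1 else 0) :> 'cV_3.
Proof.
apply/matrixP => s t; rewrite mxE sum3 /coef.
case: j s => [[|[|[|//]]] ?] [[|[|[|//]]] ?]; rewrite !mxE !inordK//=; lra.
Qed.

End Example.

Theorem proposition8p1 (R : realType) :
  exists (n : nat) (a b : tup R 3 (Fin n)),
    [/\ commuting_self_adjoint a,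
        commuting_self_adjoint b,
        (forall r : R, 0 < r -> ncball r a -> ncball r b ->
           forall (p : ncdim) (f : gmfun R 3 p), MpCK r f -> convex_fun r f ->
             ople (id_ntr (f (Fin n) a)) (id_ntr (f (Fin n) b))) &
        ~ (exists Phi : {linear opM R (Fin n) (Fin n) -> opM R (Fin n) (Fin n)},
             [/\ completely_positive Phi, unital Phi, trace_preserving Phi &
                 forall i : 'I_3, Phi (b i) = a i])].
Proof.
pose a := first_tup 2 (mxop (mxA R) : opM R (Fin 2) (Fin 2)).
pose b := first_tup 2 (mxop (mxB R) : opM R (Fin 2) (Fin 2)).
exists 2%N, a, b; split.
- by apply: first_tup_commuting; rewrite /self_adjoint adj_mxop tr_diag_mx.
- by apply: first_tup_commuting; rewrite /self_adjoint adj_mxop tr_diag_mx.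
- move=> r _ ra rb p f fC fconv u.
  rewrite bopD bopN dotDl dotNl subr_ge0 !(dot_id_ntr_diagonal _ fC)//; last 2 first.
  + exact: first_tup_diagonal.
  + exact: first_tup_diagonal.
  apply: ler_wpM2l; first by rewrite invr_ge0 ler0n.
  pose z j := first_tup 2 (mxop (pts R j) : opM R (Fin 2) (Fin 2)).
  pose c j := mxop (coef R j) : opM R (Fin 2) (Fin 2).
  have -> : b = z ord0 by [].
  apply: (@convex_fun_dot R 3 r p f 2 (Fin 2) (Fin 2) z c a u _ _ fconv).
  + move=> j; rewrite /z; have [->|[s -> s400]] := ptsP R j; first exact: rb.
    apply: ncball_scalar; apply: le_trans s400 _.
    (* The entry -20 of B forces the radius to be at least 20. *)
    have := ncball_diag_le (ord_max : 'I_3) rb; rewrite !mxE /=; lra.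
  + rewrite -[RHS](_ : mxop 1%:M = _); last by rewrite mxop_scalar scale1r.
    rewrite -coef_sum1 mxop_sum; apply: eq_bigr => j _.
    by rewrite adj_mxop mxopM.
  + move=> i; rewrite /a -coef_sumA mxop_sum first_tup_sum; apply: eq_bigr => j _.
    by rewrite tsandwich_first_tup adj_mxop !mxopM.
  + by apply: l2_ext => i; rewrite mxop_ones coef_const l2_sum_ket mxE.
  + by move=> j /negPf j0; apply: l2_ext => i; rewrite mxop_ones coef_const j0 mxE.
- move=> [Phi [PhiP Phi1 _ Phib]].
  (* 10 - B = diag(0, 0, 30) is positive, but 10 - A has the entry 10 - 12. *)
  have Bpos : opos ((10%:C)%C *: bop1 R 'I_3 - mxop (mxB R)).
    rewrite -mxop_scalar -mxopB -diag_const_mx -raddfB.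
    apply: mxop_diag_ge0 => -[[|[|[|//]]] ?]; rewrite !mxE /=; lra.
  have := completely_positive_opos PhiP Bpos.
  rewrite linearB linearZ Phi1 (Phib ord0 : Phi (mxop (mxB R)) = mxop (mxA R)).
  move=> /(_ (ket R ord0)).
  rewrite dot_ket bopD bopN bopZ bop1E l2D l2N l2Z mxop_ketE ketE eqxx mulr1 !mxE eqxx.
  by rewrite -rmorphB lecR /= mulr1n; lra.
Qed.
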